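(* Let a choice of parameters of the Diamond ensemble be given (a positive integer $n$, constants $A\ge 2$ and $c>0$, an infinite set $\mathcal{M}$ of positive integers, and for each $M\in\mathcal{M}$ admissible integers $t_\ell,\alpha_\ell,\beta_\ell$, as described in the context). Then there exists a constant $c_2\in\mathbb{R}$, depending only on the choice of parameters (not on $M$, $N$ or the phases $\theta_j$), such that for every $M\in\mathcal{M}$ and every choice of phases, $$D_{L^2,\mathrm{cap}}(\diamond(N))\le\frac{c_2}{\sqrt N},$$ where $N$ is the number of points of $\diamond(N)$.
   Context: Diamond ensemble. A choice of parameters consists of a positive integer $n$, constants $A\ge 2$ and $c>0$, an infinite set $\mathcal{M}$ of positive integers, and for each $M\in\mathcal{M}$ integers $0=t_0<t_1<\dots<t_n=M$ and $\alpha_1,\dots,\alpha_n,\beta_1,\dots,\beta_n$ (which may depend on $M$) such that: $\alpha_1=0$; $\alpha_\ell,\beta_\ell\ge 0$; $\beta_1>0$; $\alpha_\ell\le AM$ and $\beta_\ell\le A$ for all $1\le\ell\le n$; $t_1\ge cM$; and the function $r:[0,2M]\to\mathbb{R}$ defined by $r(x)=\alpha_\ell+\beta_\ell x$ for $t_{\ell-1}\le x\le t_\ell$ and $r(x)=r(2M-x)$ is well defined and continuous. The constants $A$ and $c$ do not depend on $M$. Put $p=2M-1$, $r_j=r(j)$ for $1\le j\le p$, $N=2+\sum_{j=1}^{p}r_j$, and $$z_j=1-\frac{1+r_j+2\sum_{k=1}^{j-1}r_k}{N-1},\qquad 1\le j\le p.$$ For arbitrary phases $\theta_j\in[0,2\pi]$,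 the set $\diamond(N)\subset\mathbb{S}^2$ consists of the North pole $(0,0,1)$, the South pole $(0,0,-1)$ and the points $$x_j^i=\left(\sqrt{1-z_j^2}\cos\left(\tfrac{2\pi i}{r_j}+\theta_j\right),\sqrt{1-z_j^2}\sin\left(\tfrac{2\pi i}{r_j}+\theta_j\right),z_j\right),\quad 1\le j\le p,\ 1\le i\le r_j.$$ $L^2$ spherical cap discrepancy. Let $\mu$ be surface measure on the unit sphere $\mathbb{S}^2\subset\mathbb{R}^3$, so $\mu(\mathbb{S}^2)=4\pi$, and for $u\in\mathbb{S}^2$, $t\in[-1,1]$ let $C(u,t)=\{x\in\mathbb{S}^2:\langle x,u\rangle\ge t\}$. For an $N$-point set $\omega_N\subset\mathbb{S}^2$, $$D_{L^2,\mathrm{cap}}(\omega_N)=\left(\int_{-1}^{1}\int_{\mathbb{S}^2}\left|\frac{\#(\omega_N\cap C(u,t))}{N}-\frac{\mu(C(u,t))}{4\pi}\right|^2\frac{d\mu(u)}{4\pi}\,dt\right)^{1/2}.$$ *)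

(* Defs.v *)
From HB Require Import structures.
From mathcomp Require Import all_boot all_order all_algebra finmap.
From mathcomp Require Import all_classical all_reals all_analysis.
From mathcomp Require Import measurable_realfun.
Set Implicit Arguments.
Unset Strict Implicit.
Unset Printing Implicit Defensive.
Import Order.TTheory GRing.Theory Num.Theory.
Import numFieldNormedType.Exports.
Local Open Scope classical_set_scope.
Local Open Scope ring_scope.

Notation E3 R := (R * R * R)%type.

Definition inner {R : realType} (x y : E3 R) : R :=
  x.1.1 * y.1.1 + x.1.2 * y.1.2 + x.2 * y.2.

Definition unit_sphere {R : realType} : set (E3 R) :=
  [set x | inner x x = 1].

Definition spherical_coord {R : realType} (a : R * R) : E3 R :=
  (sin a.1 * cos a.2, sin a.1 * sin a.2, cos a.1).

Definition spherical_dom {R : realType} : set (R * R) :=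
  `[0, pi] `*` `[0, 2 * pi].

(* Surface area computed in the parametrization by colatitude and longitude,
   whose area element (the norm of the cross product of the two partial
   derivatives of [spherical_coord]) is the sine of the colatitude. It is a
   measure on the ambient space, concentrated on [unit_sphere]. *)
Definition surface_measure {R : realType} (B : set (E3 R)) : \bar R :=
  (\int[(@lebesgue_measure R) \x (@lebesgue_measure R)]_(a in
     spherical_dom `&` spherical_coord @^-1` B) (sin a.1)%:E)%E.

Section surface_measure.
Context (R : realType).
Local Open Scope ereal_scope.

Lemma measurable_spherical_dom : measurable (@spherical_dom R).
Proof. by apply: measurableX; exact: measurable_itv. Qed.

Lemma measurable_spherical_coord :
  measurable_fun [set: R * R] (@spherical_coord R).
Proof.
have mS : measurable_fun [set: R] (@sin R).
  by apply: continuous_measurable_fun; exact: continuous_sin.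
have mC : measurable_fun [set: R] (@cos R).
  by apply: continuous_measurable_fun; exact: continuous_cos.
have mS1 : measurable_fun setT (fun a : R * R => sin a.1).
  exact: measurableT_comp mS measurable_fst.
have mC1 : measurable_fun setT (fun a : R * R => cos a.1).
  exact: measurableT_comp mC measurable_fst.
have mS2 : measurable_fun setT (fun a : R * R => sin a.2).
  exact: measurableT_comp mS measurable_snd.
have mC2 : measurable_fun setT (fun a : R * R => cos a.2).
  exact: measurableT_comp mC measurable_snd.
apply: measurable_fun_pair => //.
by apply: measurable_fun_pair; exact: measurable_funM.
Qed.

Lemma surface_measure0 : surface_measure (@set0 (E3 R)) = 0.
Proof. by rewrite /surface_measure preimage_set0 setI0 integral_set0. Qed.

Lemma surface_measure_ge0 (B : set (E3 R)) : 0 <= surface_measure B.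
Proof.
apply: integral_ge0 => a [[/= + _] _].
by rewrite /= in_itv /= => a1; rewrite lee_fin; exact: sin_ge0_pi.
Qed.

Lemma surface_measure_semi_sigma_additive :
  semi_sigma_additive (@surface_measure R).
Proof.
move=> F mF tF mUF.
have nng (a : R * R) : spherical_dom a -> 0 <= (sin a.1)%:E.
  by case; rewrite /= in_itv /= => a1 _; rewrite lee_fin; exact: sin_ge0_pi.
have mD n : measurable (spherical_dom `&` spherical_coord @^-1` F n).
  apply: measurableI; first exact: measurable_spherical_dom.
  by rewrite -[X in measurable X]setTI; exact: measurable_spherical_coord.
rewrite {2}/surface_measure preimage_bigcup setI_bigcupr.
rewrite ge0_integral_bigcup//=.
- apply: is_cvg_ereal_nneg_natsum_cond => n _ _.
  exact: surface_measure_ge0.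
- apply: measurable_funTS; apply/measurable_EFinP.
  have mS : measurable_fun [set: R] (@sin R).
    by apply: continuous_measurable_fun; exact: continuous_sin.
  exact: measurableT_comp mS measurable_fst.
- by move=> a [n _ [aD _]]; exact: nng.
- apply/trivIsetP => i j _ _ ij; move/trivIsetP : tF => /(_ i j I I ij) F0.
  by rewrite setIACA -preimage_setI F0 preimage_set0 setI0.
Qed.

HB.instance Definition _ := isMeasure.Build _ _ _ (@surface_measure R)
  surface_measure0 surface_measure_ge0 surface_measure_semi_sigma_additive.

End surface_measure.

Definition cap {R : realType} (u : E3 R) (t : R) : set (E3 R) :=
  [set x | unit_sphere x /\ t <= inner x u].

Definition card_pts {R : realType} (omega : set (E3 R)) : R :=
  #|` fset_set omega|%fset%:R.

Definition L2_cap_discrepancy {R : realType} (omega : set (E3 R)) : \bar R :=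
  sqrte (\int[@lebesgue_measure R]_(t in `[(-1)%R, 1%R])
    \int[@surface_measure R]_(u in unit_sphere)
      (`|card_pts (omega `&` cap u t) / card_pts omega
         - fine (surface_measure (cap u t)) / (4 * pi)| ^+ 2 / (4 * pi))%:E)%E.

Record diamond_parameters (R : realType) := DiamondParameters {
  dp_n : nat;
  dp_A : R;
  dp_c : R;
  dp_Ms : set nat;
  (* Arguments: M, then the index l. Nonnegativity of the integers t_l,
     alpha_l and beta_l is carried by the type nat. *)
  dp_t : nat -> nat -> nat;
  dp_alpha : nat -> nat -> nat;
  dp_beta : nat -> nat -> nat;
  (* [dp_r M] only matters on [0, 2M], where it is determined by the fields
     [dp_r_piece] and [dp_r_sym]; that such a function exists is the
     requirement that r be well defined. *)
  dp_r : nat -> R -> R;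
  dp_n_gt0 : (0 < dp_n)%N;
  dp_A_ge2 : 2 <= dp_A;
  dp_c_gt0 : 0 < dp_c;
  dp_Ms_infinite : infinite_set dp_Ms;
  dp_Ms_gt0 : forall M, dp_Ms M -> (0 < M)%N;
  dp_t0 : forall M, dp_Ms M -> dp_t M 0 = 0%N;
  dp_tn : forall M, dp_Ms M -> dp_t M dp_n = M;
  dp_t_lt : forall M l, dp_Ms M -> (1 <= l <= dp_n)%N ->
    (dp_t M l.-1 < dp_t M l)%N;
  dp_t1_ge : forall M, dp_Ms M -> dp_c * M%:R <= (dp_t M 1)%:R;
  dp_alpha1 : forall M, dp_Ms M -> dp_alpha M 1 = 0%N;
  dp_beta1 : forall M, dp_Ms M -> (0 < dp_beta M 1)%N;
  dp_alpha_le : forall M l, dp_Ms M -> (1 <= l <= dp_n)%N ->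
    (dp_alpha M l)%:R <= dp_A * M%:R;
  dp_beta_le : forall M l, dp_Ms M -> (1 <= l <= dp_n)%N ->
    (dp_beta M l)%:R <= dp_A;
  dp_r_piece : forall M l (x : R), dp_Ms M -> (1 <= l <= dp_n)%N ->
    (dp_t M l.-1)%:R <= x <= (dp_t M l)%:R ->
    dp_r M x = (dp_alpha M l)%:R + (dp_beta M l)%:R * x;
  dp_r_sym : forall M (x : R), dp_Ms M -> 0 <= x <= 2 * M%:R ->
    dp_r M x = dp_r M (2 * M%:R - x);
  dp_r_cont : forall M, dp_Ms M ->
    {within `[0, 2 * M%:R], continuous (dp_r M)}
}.

Section diamond.
Context {R : realType} (P : diamond_parameters R) (M : nat).

Definition nparallels : nat := (2 * M - 1)%N.

Definition rj (j : nat) : R := dp_r P M j%:R.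

Definition npoints : R := 2 + \sum_(1 <= j < nparallels.+1) rj j.

Definition zj (j : nat) : R :=
  1 - (1 + rj j + 2 * \sum_(1 <= k < j) rj k) / (npoints - 1).

Definition diamond_point (theta : nat -> R) (j i : nat) : E3 R :=
  (Num.sqrt (1 - zj j ^+ 2) * cos (2 * pi * i%:R / rj j + theta j),
   Num.sqrt (1 - zj j ^+ 2) * sin (2 * pi * i%:R / rj j + theta j),
   zj j).

(* [rj j] is an integer-valued real, hence the comparison [i%:R <= rj j]. *)
Definition diamond (theta : nat -> R) : set (E3 R) :=
  [set (0, 0, 1); (0, 0, -1)] `|`
  [set x | exists j i, [/\ (1 <= j <= nparallels)%N, (1 <= i)%N,
                           i%:R <= rj j & x = diamond_point theta j i]].

End diamond.

(* Main.v *)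
Require Import Defs.
From mathcomp Require Import all_boot all_order all_algebra finmap.
From mathcomp Require Import all_classical all_reals all_analysis.
From mathcomp Require Import measurable_realfun lra ring zify.
(* It suffices to bound, uniformly over all caps, the error between the
   proportion of points in a cap and its normalized area by a multiple of 1/M,
   since N is comparable to M^2. A cap meets a meridian (a half-circle) and each
   half of a parallel in an arc or in the complement of an arc, because it is
   cut out there by an inequality [t <= p cos x + q sin x]. Cut each meridian
   into the bands around the parallels, of area proportional to the number of
   points they carry, and each parallel into equal arcs containing one point
   each: an arc only cuts two cells, so that replacing lengths by sample points
   costs two cells. On meridians this costs O(max r_j / N) = O(1/M); on each of
   the 2M - 1 parallels it costs O(1) points, hence O(M/N) = O(1/M) in total. *)
Import Order.TTheory GRing.Theory Num.Theory.
Import numFieldNormedType.Exports.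
Local Open Scope classical_set_scope.
Local Open Scope ring_scope.

(** * Arcs cut out on a circle by a half-plane *)

Lemma sin_ge_comb {R : realType} (p q x1 x2 x3 : R) :
  sin (x3 - x1) * (p * cos x2 + q * sin x2) =
  sin (x3 - x2) * (p * cos x1 + q * sin x1) +
  sin (x2 - x1) * (p * cos x3 + q * sin x3).
Proof.
have h x : sin x ^+ 2 = 1 - cos x ^+ 2 :> R by exact: sin2cos2.
rewrite !sinB; have := h x1; have := h x2; have := h x3.
set s1 := sin x1; set s2 := sin x2; set s3 := sin x3.
set c1 := cos x1; set c2 := cos x2; set c3 := cos x3 => h3 h2 h1.
ring.
Qed.

Lemma sinD_le {R : realType} (x y : R) : 0 <= x <= pi -> 0 <= y <= pi ->
  sin (x + y) <= sin x + sin y.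
Proof.
move=> /sin_ge0_pi sx /sin_ge0_pi sy; rewrite sinD.
by rewrite lerD// ?[cos x * _]mulrC ler_piMr// cos_le1.
Qed.

Definition trig_half {R : realType} (p q t : R) : set R :=
  [set x | t <= p * cos x + q * sin x].

(* On a half-period, [p cos + q sin] at an intermediate point is a combination
   of its values at the ends, with nonnegative weights of sum at least 1; so
   the superlevel set is an interval when [0 <= t], and its complement is one
   when [t < 0]. *)
Lemma trig_half_interval {R : realType} (p q t a : R) :
  is_interval (`[a, a + pi[ `&` trig_half p q t) \/
  is_interval (`[a, a + pi[ `\` trig_half p q t).
Proof.
have key x1 x2 x3 : a <= x1 -> x3 < a + pi -> x1 <= x2 <= x3 ->
    x1 = x3 \/ [/\ 0 < sin (x3 - x1), 0 <= sin (x3 - x2), 0 <= sin (x2 - x1) &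
     sin (x3 - x1) <= sin (x3 - x2) + sin (x2 - x1)].
  move=> ax1 x3a /andP[x12 x23].
  have [->|x13] := eqVneq x1 x3; [by left|right].
  have x13' : x1 < x3 by rewrite lt_neqAle x13 (le_trans x12).
  split.
  - by apply: sin_gt0_pi; apply/andP; split; lra.
  - by apply: sin_ge0_pi; apply/andP; split; lra.
  - by apply: sin_ge0_pi; apply/andP; split; lra.
  - have -> : x3 - x1 = (x3 - x2) + (x2 - x1) by ring.
    by apply: sinD_le; apply/andP; split; lra.
have [t0|t0] := leP 0 t; [left|right].
- move=> x3 x1 [/= + v3] [/= + v1] x2 /andP[x32 x21].
  rewrite !in_itv/= => /andP[a3 a3'] /andP[a1 a1'].
  split; first by rewrite /=; apply/andP; split; lra.
  have [e|[s0 s1 s2 s3]] := key x3 x2 x1 a3 a1' (introT andP (conj x32 x21)).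
    by have -> : x2 = x1 by apply/eqP; rewrite eq_le; apply/andP; split; lra.
  rewrite /trig_half/= in v1 v3 *; rewrite -(ler_pM2l s0) sin_ge_comb.
  apply: (@le_trans _ _ ((sin (x1 - x2) + sin (x2 - x3)) * t)).
    by rewrite ler_wpM2r.
  by rewrite mulrDl lerD// ler_wpM2l.
- move=> x3 x1 [/= + v3] [/= + v1] x2 /andP[x32 x21].
  rewrite !in_itv/= => /andP[a3 a3'] /andP[a1 a1'].
  split; first by rewrite /=; apply/andP; split; lra.
  have [e|[s0 s1 s2 s3]] := key x3 x2 x1 a3 a1' (introT andP (conj x32 x21)).
    by have -> : x2 = x1 by apply/eqP; rewrite eq_le; apply/andP; split; lra.
  rewrite /trig_half/=; apply/negP; rewrite -ltNge.
  move: v1 v3 => /negP; rewrite -ltNge => v1 /negP; rewrite -ltNge => v3.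
  rewrite -(ltr_pM2l s0) sin_ge_comb.
  apply: (@lt_le_trans _ _ ((sin (x1 - x2) + sin (x2 - x3)) * t)); last first.
    by rewrite ler_wnM2r// ltW.
  rewrite mulrDl.
  have [z|z] := eqVneq (sin (x1 - x2)) 0.
    have s4 : 0 < sin (x2 - x3) by lra.
    by rewrite z !mul0r !add0r (ltr_pM2l s4).
  have s4 : 0 < sin (x1 - x2) by rewrite lt_neqAle eq_sym z.
  by rewrite ltr_leD// ?(ltr_pM2l s4)// ler_wpM2l// ltW.
Qed.

Lemma measurable_trig_half {R : realType} (p q t : R) :
  measurable (trig_half p q t).
Proof.
have mS : measurable_fun [set: R] (@sin R).
  by apply: continuous_measurable_fun; exact: continuous_sin.
have mC : measurable_fun [set: R] (@cos R).
  by apply: continuous_measurable_fun; exact: continuous_cos.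
rewrite -[trig_half _ _ _]setTI.
have -> : trig_half p q t = (fun x => p * cos x + q * sin x) @^-1` `[t, +oo[.
  by apply/seteqP; split => x /=; rewrite in_itv/= andbT.
have m : measurable_fun [set: R] (fun x => p * cos x + q * sin x).
  by apply: measurable_funD; exact: measurable_funM.
by apply: m => //; exact: measurable_itv.
Qed.

(** * Sampling an interval by the cells of a partition *)

Section cells.
Context {R : realType} (nu : set R -> R) (b s : nat -> R) (K : nat) (E : R).
Let D : set R := `[b 0, b K[.
Let cell k : set R := `[b k, b k.+1[.
Hypothesis E_ge0 : 0 <= E.
Hypothesis nu_ge0 : forall A, measurable A -> A `<=` D -> 0 <= nu A.
Hypothesis nuU : forall A B, measurable A -> measurable B ->
  A `<=` D -> B `<=` D -> A `&` B = set0 -> nu (A `|` B) = nu A + nu B.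
Hypothesis s_cell : forall k, (k < K)%N -> b k <= s k < b k.+1.
Hypothesis nu_cell : forall k, (k < K)%N -> nu `[b k, b k.+1[ <= E.

Definition sampling_error (I : set R) : R :=
  nu (I `&` D) - \sum_(k < K) nu `[b k, b k.+1[ * \1_I (s k).

Let b_lt k : (k < K)%N -> b k < b k.+1.
Proof. by move=> /s_cell/andP[]; exact: le_lt_trans. Qed.

Let b_le i j : (i <= j)%N -> (j <= K)%N -> b i <= b j.
Proof.
move=> ij; rewrite -(subnK ij); elim: (j - i)%N => //= n IH nK.
by rewrite addSn (le_trans (IH _))// ?ltW// ?b_lt// ltnW.
Qed.

Let cellD k : (k < K)%N -> cell k `<=` D.
Proof.
move=> kK x; rewrite /cell /D /= !in_itv/= => /andP[bx xb].
rewrite (le_trans _ bx)/=; last by rewrite b_le// ltnW.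
by rewrite (lt_le_trans xb)// b_le.
Qed.

Let nu0 : nu set0 = 0.
Proof.
have := nuU set0 set0 measurable0 measurable0 (sub0set _) (sub0set _) (setI0 _).
by rewrite setU0 => /eqP; rewrite -subr_eq subrr => /eqP <-.
Qed.

Let nu_le A B : measurable A -> measurable B -> A `<=` B -> B `<=` D ->
  nu A <= nu B.
Proof.
move=> mA mB AB BD.
have -> : B = A `|` (B `\` A) by rewrite setDUK.
have mBA : measurable (B `\` A) by exact: measurableD.
rewrite nuU//.
- rewrite lerDl nu_ge0// => x [/BD//].
- exact: subset_trans BD.
- by move=> x [/BD].
- by rewrite setDIK.
Qed.

Let nu_sum I : measurable I -> nu (I `&` D) = \sum_(k < K) nu (I `&` cell k).
Proof.
move=> mI.
suff H m : (m <= K)%N ->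
    nu (I `&` `[b 0, b m[) = \sum_(k < m) nu (I `&` cell k).
  by rewrite -H.
elim: m => [_|m IH mK].
  by rewrite big_ord0 set_itvco0 setI0 nu0.
rewrite big_ord_recr/= -IH 1?ltnW//.
have bm : b 0 <= b m by rewrite b_le// ltnW.
have -> : `[b 0, b m.+1[%classic = `[b 0, b m[%classic `|` cell m.
  rewrite /cell -itv_bndbnd_setU// bnd_simp//; exact/ltW/b_lt.
rewrite setIUr nuU//.
- by apply: measurableI => //; exact: measurable_itv.
- by apply: measurableI => //; exact: measurable_itv.
- move=> x [_]; rewrite /D /= !in_itv/= => /andP[-> /lt_le_trans->]//.
  by rewrite b_le// ltnW.
- by move=> x [_]; apply: cellD.
- rewrite setIACA [X in _ `&` X](_ : _ = set0) ?setI0//.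
  apply/seteqP; split => // x [] /=; rewrite /cell/= !in_itv/=.
  by move=> /andP[_ +] /andP[+ _]; rewrite ltNge => /negP.
Qed.

Let cut (I : set R) k := `[< cell k `&` I !=set0 /\ ~ (cell k `<=` I) >].

Let cut_le2 I : is_interval I -> (#|[pred k : 'I_K | cut I k]| <= 2)%N.
Proof.
move=> II.
have no3 (i j k : 'I_K) : (i < j < k)%N -> cut I i -> cut I j -> cut I k -> False.
  move=> /andP[ij jk] /asboolP[[x [cx Ix]] _] /asboolP[_ nj].
  move=> /asboolP[[y [cy Iy]] _]; apply: nj => z cz.
  move: cx cy cz; rewrite /cell/= !in_itv/= => /andP[_ xi] /andP[yk _].
  move=> /andP[zj jz]; apply: (II _ _ Ix Iy); apply/andP; split.
    by rewrite (le_trans (ltW xi))// (le_trans _ zj)// b_le// ltnW.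
  by rewrite (le_trans (ltW jz))// (le_trans _ yk)// b_le// ltnW.
rewrite leqNgt; apply/negP => /card_gt2P[x [y [z [[]]]]].
move=> cx cy cz [xy yz zx].
case: (ltngtP x y) => [h1|h1|/val_inj h1]; last by rewrite h1 eqxx in xy.
  case: (ltngtP y z) => [h2|h2|/val_inj h2]; last by rewrite h2 eqxx in yz.
    by apply: (no3 x y z) => //; apply/andP; split.
  case: (ltngtP x z) => [h3|h3|/val_inj h3]; last by rewrite h3 eqxx in zx.
    by apply: (no3 x z y) => //; apply/andP; split.
  by apply: (no3 z x y) => //; apply/andP; split.
case: (ltngtP y z) => [h2|h2|/val_inj h2]; last by rewrite h2 eqxx in yz.
  case: (ltngtP x z) => [h3|h3|/val_inj h3]; last by rewrite h3 eqxx in zx.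
    by apply: (no3 y x z) => //; apply/andP; split.
  by apply: (no3 y z x) => //; apply/andP; split.
by apply: (no3 z y x) => //; apply/andP; split.
Qed.

(* Only the cells that meet the interval without being contained in it
   contribute, and there are at most two of them. *)
Lemma sampling_error_interval I : is_interval I ->
  `|sampling_error I| <= 2 * E.
Proof.
move=> II; have mI : measurable I by exact: is_interval_measurable.
have mc k : measurable (cell k) by exact: measurable_itv.
rewrite /sampling_error nu_sum// -sumrB (le_trans (ler_norm_sum _ _ _))//.
apply: (@le_trans _ _ (\sum_(k < K) (cut I k)%:R * E)); last first.
  rewrite -mulr_suml ler_wpM2r//.
  have := cut_le2 _ II; rewrite -(ler_nat R); apply: le_trans.
  rewrite -sum1_card natr_sum big_mkcond/= [leRHS]big_mkcond/= ler_sum// => k _.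
  have -> : (k \in [pred k0 : 'I_K | cut I k0]) = cut I k by [].
  by case: (cut I k).
apply: ler_sum => -[k kK] _ /=.
have csub : I `&` cell k `<=` cell k by exact: subIsetr.
have cD := cellD _ kK.
have le1 : nu (I `&` cell k) <= nu (cell k).
  by apply: nu_le => //; exact: measurableI.
have ge0 : 0 <= nu (I `&` cell k).
  by apply: nu_ge0; [exact: measurableI|exact: subset_trans cD].
have leE := nu_cell _ kK.
have sk : cell k (s k) by rewrite /cell/= in_itv/= s_cell.
have [Ik|Ik] := eqVneq (cell k `&` I) set0.
  rewrite setIC Ik nu0 indicE memNset ?mulr0 ?subrr ?normr0 ?mulr_ge0//.
  by move=> Is; have : set0 (s k) by rewrite -Ik.
have [cI|cI] := pselect (cell k `<=` I).
  have -> : I `&` cell k = cell k by rewrite setIC; exact: setIidl.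
  rewrite indicE mem_set ?mulr1 ?subrr ?normr0 ?mulr_ge0//.
  exact: cI.
have -> : cut I k by apply/asboolP; split => //; apply/set0P.
rewrite mul1r indicE; case: (_ \in _); rewrite ?mulr1 ?mulr0 ?subr0.
  rewrite distrC ger0_norm ?subr_ge0//; rewrite /cell in ge0 le1 leE; lra.
by rewrite ger0_norm// (le_trans le1).
Qed.

Lemma sampling_errorU (I J : set R) : measurable I -> measurable J -> I `&` J = set0 ->
  sampling_error (I `|` J) = sampling_error I + sampling_error J.
Proof.
move=> mI mJ IJ; rewrite /sampling_error setIUl nuU; last 5 first.
- by apply: measurableI => //; exact: measurable_itv.
- by apply: measurableI => //; exact: measurable_itv.
- exact: subIsetr.
- exact: subIsetr.
- by rewrite setIACA IJ set0I.
have -> : \sum_(k < K) nu `[b k, b k.+1[ * \1_(I `|` J) (s k) =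
  \sum_(k < K) nu `[b k, b k.+1[ * \1_I (s k) +
  \sum_(k < K) nu `[b k, b k.+1[ * \1_J (s k).
  rewrite -big_split/=; apply: eq_bigr => k _; rewrite -mulrDr; congr (_ * _).
  rewrite !indicE in_setU; case: (boolP (_ \in I)) => [sI|_]; last by rewrite add0r.
  rewrite memNset ?addr0// => sJ.
  by have : set0 (s k) by rewrite -IJ; split => //; exact/set_mem.
ring.
Qed.

Lemma sampling_error_half (I J : set R) : is_interval I -> measurable J ->
  is_interval (I `&` J) \/ is_interval (I `\` J) ->
  `|sampling_error (I `&` J)| <= 4 * E.
Proof.
move=> II mJ IJ; have mI : measurable I by exact: is_interval_measurable.
have E0 := E_ge0.
case: IJ => [/sampling_error_interval|/sampling_error_interval] eIJ.
  by rewrite (le_trans eIJ)//; lra.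
have eI := sampling_error_interval _ II.
have eU : sampling_error I = sampling_error (I `&` J) + sampling_error (I `\` J).
  rewrite -sampling_errorU//.
  - by rewrite setUIDK.
  - exact: measurableI.
  - exact: measurableD.
  - by rewrite setDE setIACA setICr setI0.
have -> : sampling_error (I `&` J) = sampling_error I - sampling_error (I `\` J).
  by rewrite eU addrK.
by rewrite (le_trans (ler_normB _ _))//; lra.
Qed.

End cells.

(** * Parallels *)

Lemma big_ord_shift_periodic {V : zmodType} (r m : nat) (G : nat -> V) :
  (forall i, G (i + r)%N = G i) ->
  \sum_(i < r) G (i + m)%N = \sum_(i < r) G i.
Proof.
move=> GP; elim: m => [|m IH]; first by apply: eq_bigr => i _; rewrite addn0.
rewrite -IH; case: r GP {IH} => [|r] GP; first by rewrite !big_ord0.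
rewrite big_ord_recr [RHS]big_ord_recl/= addrC; congr (_ + _).
  by rewrite -[RHS]GP; congr G; lia.
by apply: eq_bigr => i _; congr G; rewrite /= /bump/=; lia.
Qed.

Lemma trig_half_2pi {R : realType} (p q t x : R) (n : nat) :
  trig_half p q t (x + n%:R * (2 * pi)) = trig_half p q t x.
Proof.
elim: n => [|n IH]; first by rewrite mul0r addr0.
rewrite -IH -natr1 mulrDl mul1r addrA [2 * pi]mulr_natl /trig_half/=.
by rewrite cosD2pi sinD2pi.
Qed.

Lemma circle_count {R : realType} (p q t theta : R) (r : nat) :
  (0 < r)%N -> 0 <= theta ->
  `|fine (lebesgue_measure (trig_half p q t `&` `[0, 2 * pi[))
    - 2 * pi / r%:R *
      \sum_(1 <= i < r.+1) \1_(trig_half p q t) (2 * pi * i%:R / r%:R + theta)|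
  <= 8 * (2 * pi / r%:R).
Proof.
move=> r0 theta0; set J := trig_half p q t; set w := 2 * pi / r%:R.
have pi0 : 0 < (pi : R) := pi_gt0 R.
have rR : 0 < r%:R :> R by rewrite ltr0n.
have w0 : 0 < w by rewrite divr_gt0// mulr_gt0.
have wr : r%:R * w = 2 * pi by rewrite mulrC divfK// gt_eqF.
pose m := Num.truncn (theta / w).
have /andP[m1 m2] : m%:R <= theta / w < m.+1%:R.
  by apply: truncn_itv; rewrite divr_ge0// ltW.
pose th := theta - m%:R * w.
have th0 : 0 <= th by rewrite subr_ge0 -ler_pdivlMr.
have thw : th < w.
  by rewrite ltrBlDl -[X in _ < _ + X]mul1r -mulrDl natr1 -ltr_pdivrMr.
pose b (k : nat) := k%:R * w; pose s k := b k + th.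
have b0 : b 0%N = 0 by rewrite /b mul0r.
have br : b r = 2 * pi by rewrite /b wr.
pose nu (A : set R) := fine (lebesgue_measure A).
have mJ : measurable J by exact: measurable_trig_half.
have bS k : b k.+1 = b k + w by rewrite /b -natr1 mulrDl mul1r.
have lebD : lebesgue_measure (`[b 0%N, b r[ : set R) = (2 * pi)%:E.
  rewrite b0 br lebesgue_measure_itv/= lte_fin mulr_gt0//.
  by rewrite oppr0 adde0.
have mD : measurable (`[b 0%N, b r[%classic : set R) by exact: measurable_itv.
have finA (A : set R) : measurable A -> A `<=` `[b 0%N, b r[ ->
    lebesgue_measure A \is a fin_num.
  move=> mA AD; rewrite ge0_fin_numE//.
  apply: (@le_lt_trans _ _ (lebesgue_measure (`[b 0%N, b r[ : set R))).
    by apply: le_measure => //; rewrite inE.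
  by rewrite lebD ltry.
have nucell k : nu `[b k, b k.+1[%classic = w.
  rewrite /nu bS lebesgue_measure_itv/= lte_fin ltrDl w0 -EFinB/=; ring.
have eH (I : set R) : is_interval I ->
    is_interval (I `&` J) \/ is_interval (I `\` J) ->
    `|sampling_error nu b s r (I `&` J)| <= 4 * w.
  move=> II; apply: sampling_error_half => //.
  - exact: ltW.
  - by move=> A _ _; exact: fine_ge0.
  - move=> A B mA mB AD BD AB; rewrite /nu measureU// fineD//; exact: finA.
  - by move=> k _; rewrite bS /s lerDl th0 ltrD2l.
  - by move=> k _; rewrite nucell.
have eU (I1 I2 : set R) : measurable I1 -> measurable I2 -> I1 `&` I2 = set0 ->
    sampling_error nu b s r (I1 `|` I2) =
    sampling_error nu b s r I1 + sampling_error nu b s r I2.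
  apply: sampling_errorU => A B mA mB AD BD AB.
  by rewrite /nu measureU// fineD//; exact: finA.
have mI a c : measurable (`[a, c[%classic : set R) by exact: measurable_itv.
have -> : J `&` `[0, 2 * pi[ =
  (`[0, 0 + pi[ `&` J `|` `[pi, pi + pi[ `&` J) `&` `[b 0%N, b r[.
  rewrite -setIUl b0 br; apply/seteqP; split => x /=; rewrite !in_itv/=.
    move=> [Jx /andP[x0 x2]]; split; last by rewrite x0 x2.
    by split => //; rewrite add0r x0/=; have [|] := ltP x pi; [left|right]; lra.
  by move=> [[_ Jx] h].
have := eU _ _ (measurableI _ _ (mI 0 (0 + pi)) mJ)
               (measurableI _ _ (mI pi (pi + pi)) mJ).
rewrite setIACA [X in X `&` _](_ : _ = set0); last first.
  apply/seteqP; split => // x [] /=; rewrite !in_itv/= add0r.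
  by move=> /andP[_ h1] /andP[h2 _]; lra.
rewrite set0I => /(_ erefl); rewrite {1}/sampling_error.
under eq_bigr do rewrite nucell.
rewrite -mulr_sumr.
have -> : \sum_(k < r) \1_(`[0, 0 + pi[ `&` J `|` `[pi, pi + pi[ `&` J) (s k) =
  \sum_(1 <= i < r.+1) \1_J (2 * pi * i%:R / r%:R + theta) :> R.
  rewrite big_add1/= big_mkord.
  pose G (i : nat) : R := \1_J (s i).
  have GP i : G (i + r)%N = G i.
    have sr : s (i + r)%N = s i + 1%:R * (2 * pi).
      by rewrite /s /b natrD mulrDl wr mul1r addrAC.
    rewrite /G !indicE; congr ((_ : bool)%:R).
    by apply/idP/idP; rewrite !inE /J sr trig_half_2pi.
  rewrite -[RHS](_ : \sum_(i < r) G (i + m.+1)%N = _); last first.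
    apply: eq_bigr => i _; rewrite /G /s /b /th; congr (\1_J _).
    rewrite addnS -addSn natrD /w; ring.
  rewrite big_ord_shift_periodic//; apply: eq_bigr => i _.
  rewrite /G !indicE; congr ((_ : bool)%:R); rewrite -setIUl in_setI.
  rewrite andb_idl// => _; rewrite inE/=  !in_itv/= add0r.
  have : b i + w <= 2 * pi.
    by rewrite -wr -bS /b ler_pM2r// ler_nat.
  have : 0 <= b i by rewrite /b mulr_ge0// ltW.
  rewrite /s => h1 h2.
  by have [|] := ltP (b i + th) pi; [left|right]; lra.
move=> ->; apply: (le_trans (ler_normD _ _)).
have e1 := eH _ (@interval_is_interval _ _) (trig_half_interval p q t 0).
have e2 := eH _ (@interval_is_interval _ _) (trig_half_interval p q t pi).
have -> : 8 * w = 4 * w + 4 * w by ring.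
exact: lerD.
Qed.

(** * Meridians *)

Lemma acos_lt {R : realType} (x y : R) : -1 <= x -> x < y -> y <= 1 ->
  acos y < acos x.
Proof.
move=> x1 xy y1.
have hx : x \in `[-1, 1] by rewrite in_itv/= x1 (le_trans (ltW xy)).
have hy : y \in `[-1, 1] by rewrite in_itv/= y1 (le_trans x1 (ltW xy)).
rewrite -ltr_cos; first by rewrite !acosK.
- by move: hy; rewrite !in_itv/= => hy; rewrite acos_ge0//= acos_lepi.
- by move: hx; rewrite !in_itv/= => hx; rewrite acos_ge0//= acos_lepi.
Qed.

Lemma integrable_sin {R : realType} (a b : R) :
  (@lebesgue_measure R).-integrable `[a, b] (EFin \o (@sin R)).
Proof.
apply: continuous_compact_integrable; first exact: segment_compact.
by apply: continuous_subspaceT; exact: continuous_sin.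
Qed.

Lemma Rintegral_sin {R : realType} (a b : R) : a < b ->
  \int[lebesgue_measure]_(x in `[a, b[) sin x = cos a - cos b.
Proof.
move=> ab; rewrite Rintegral_itv_bndo_bndc; last first.
  by apply: integrableS (integrable_sin a b) => //; apply: subset_itvl; rewrite bnd_simp.
rewrite /Rintegral (@continuous_FTC2 _ _ (fun x => - cos x)) => //.
- by rewrite -EFinB/=; ring.
- by apply: continuous_subspaceT; exact: continuous_sin.
- split.
  + by move=> x _; apply: derivableN; exact: derivable_cos.
  + apply: cvgN; apply: cvg_at_right_filter; exact: continuous_cos.
  + apply: cvgN; apply: cvg_at_left_filter; exact: continuous_cos.
- move=> x _; rewrite derive1E deriveN; last exact: derivable_cos.
  by rewrite derive_val opprK.
Qed.

Section latitudes.
Context {R : realType} (rho : nat -> R) (K : nat).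
Let T := \sum_(k < K) rho k.

Definition band_edge (k : nat) : R := 1 - 2 * (\sum_(i < k) rho i) / T.

Definition band_middle (k : nat) : R :=
  1 - (rho k + 2 * \sum_(i < k) rho i) / T.

Hypothesis K_gt0 : (0 < K)%N.
Hypothesis rho_gt0 : forall k, (k < K)%N -> 0 < rho k.

Lemma sum_rho_gt0 k : (0 < k)%N -> (k <= K)%N -> 0 < \sum_(i < k) rho i.
Proof.
case: k => // k _ kK; rewrite big_ord_recr/= ltr_wpDl ?rho_gt0//.
by apply: sumr_ge0 => i _; rewrite ltW// rho_gt0// (ltn_trans _ kK).
Qed.

Let T_gt0 : 0 < T. Proof. exact: sum_rho_gt0. Qed.

Lemma sum_rho_ge0 k : (k <= K)%N -> 0 <= \sum_(i < k) rho i.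
Proof.
by case: k => [|k] kK; [rewrite big_ord0|exact/ltW/sum_rho_gt0].
Qed.

Lemma sum_rho_le k : (k <= K)%N -> \sum_(i < k) rho i <= T.
Proof.
move=> kK; rewrite /T -!(big_mkord xpredT) (@big_cat_nat _ _ _ k 0 K)//= lerDl.
rewrite big_nat; apply: sumr_ge0 => i /andP[_ iK]; exact/ltW/rho_gt0.
Qed.

Lemma band_edge_itv k : (k <= K)%N -> -1 <= band_edge k <= 1.
Proof.
move=> kK; rewrite /band_edge.
have : 0 <= (\sum_(i < k) rho i) / T <= 1.
  by rewrite divr_ge0 ?sum_rho_ge0 ?(ltW T_gt0)//= ler_pdivrMr// mul1r sum_rho_le.
by rewrite -mulrA => /andP[h1 h2]; apply/andP; split; lra.
Qed.

Lemma band_edgeS k : band_edge k - band_edge k.+1 = 2 * rho k / T.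
Proof. by rewrite /band_edge big_ord_recr/=; ring. Qed.

Lemma band_middleE k : band_middle k = band_edge k - rho k / T.
Proof. by rewrite /band_edge /band_middle; ring. Qed.

Lemma band_middle_lt k : (k < K)%N -> band_edge k.+1 < band_middle k < band_edge k.
Proof.
move=> kK; rewrite band_middleE.
have h : 0 < rho k / T by rewrite divr_gt0// rho_gt0.
have := band_edgeS k; rewrite -mulrA => e; apply/andP; split; lra.
Qed.

Lemma band_middle_itv k : (k < K)%N -> -1 < band_middle k < 1.
Proof.
move=> kK; have /andP[h1 h2] := band_middle_lt _ kK.
have /andP[h3 _] := band_edge_itv _ kK.
have /andP[_ h4] := band_edge_itv _ (ltnW kK).
by apply/andP; split; [exact: le_lt_trans h1|exact: lt_le_trans h4].
Qed.

Lemma band_middle_decr i j : (i < j < K)%N -> band_middle j < band_middle i.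
Proof.
move=> /andP[ij jK].
have /andP[_ h1] := band_middle_lt _ jK.
have /andP[h2 _] := band_middle_lt _ (ltn_trans ij jK).
apply: (lt_trans h1); apply: le_lt_trans h2.
rewrite /band_edge lerD2l lerN2 ler_pM2r ?invr_gt0// ler_pM2l//.
rewrite -!(big_mkord xpredT) (@big_cat_nat _ _ _ i.+1 0 j)//= lerDl.
rewrite big_nat; apply: sumr_ge0 => k /andP[_ kj].
by rewrite ltW// rho_gt0// (ltn_trans kj).
Qed.

Lemma meridian_sampling (p q t B : R) :
  (forall k, (k < K)%N -> rho k <= B) ->
  `|\int[lebesgue_measure]_(x in trig_half p q t `&` `[0, pi[) sin x
    - \sum_(k < K) 2 * rho k / T * \1_(trig_half p q t) (acos (band_middle k))|
  <= 8 * B / T.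
Proof.
move=> rhoB; set J := trig_half p q t.
pose b k := acos (band_edge k); pose s k := acos (band_middle k).
pose nu (A : set R) := \int[lebesgue_measure]_(x in A) sin x.
have b0 : b 0%N = 0 by rewrite /b /band_edge big_ord0 mulr0 mul0r subr0 acos1.
have bK : b K = pi.
  rewrite /b /band_edge -/T -mulrA divff ?gt_eqF// mulr1.
  by rewrite (_ : 1 - 2 = -1) ?acosN1//; ring.
have bs k : (k < K)%N -> b k < s k < b k.+1.
  move=> kK; have /andP[h1 h2] := band_middle_lt _ kK.
  have /andP[h3 _] := band_edge_itv _ kK.
  have /andP[_ h4] := band_edge_itv _ (ltnW kK).
  have /andP[h5 h6] := band_middle_itv _ kK.
  by rewrite !acos_lt// ltW.
have nucell k : (k < K)%N -> nu `[b k, b k.+1[%classic = 2 * rho k / T.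
  move=> kK; have /andP[h1 h2] := bs _ kK.
  rewrite /nu Rintegral_sin; last exact: lt_trans h2.
  by rewrite !acosK ?band_edgeS// in_itv/= band_edge_itv// ltnW.
have iD A : measurable A -> A `<=` `[b 0%N, b K[ ->
    (@lebesgue_measure R).-integrable A (EFin \o (@sin R)).
  move=> mA AD; apply: integrableS (integrable_sin 0 pi) => //.
  by apply: subset_trans AD _; rewrite b0 bK; apply: subset_itvl; rewrite bnd_simp.
have mJ : measurable J by exact: measurable_trig_half.
have : `|sampling_error nu b s K (`[0, 0 + pi[ `&` J)| <= 4 * (2 * B / T).
  apply: sampling_error_half => //.
  - rewrite divr_ge0 ?(ltW T_gt0)// mulr_ge0//.
    by rewrite (le_trans _ (rhoB _ K_gt0))// ltW// rho_gt0.
  - move=> A mA AD; apply: Rintegral_ge0 => x /AD.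
    rewrite b0 bK /= in_itv/= => /andP[x0 xpi].
    by apply: sin_ge0_pi; rewrite x0 ltW.
  - move=> A A' mA mA' AD A'D AA'; rewrite /nu Rintegral_setU//.
      by apply: iD; [exact: measurableU|rewrite subUset].
    by rewrite disj_set2E AA'.
  - by move=> k /bs/andP[h1 h2]; rewrite (ltW h1).
  - move=> k kK; rewrite nucell// ler_pM2r ?invr_gt0// ler_pM2l//.
    exact: rhoB.
  - exact: interval_is_interval.
  - exact: trig_half_interval.
rewrite /sampling_error add0r b0 bK (setIC `[0, pi[%classic J) -setIA setIid /nu.
have -> : \sum_(k < K) \int[lebesgue_measure]_(x in `[b k, b k.+1[) sin x *
   \1_(J `&` `[0, pi[) (s k) = \sum_(k < K) 2 * rho k / T * \1_J (s k).
  apply: eq_bigr => -[k kK] _ /=; rewrite -/(nu _) nucell//; congr (_ * _).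
  rewrite !indicE; congr ((_ : bool)%:R); rewrite in_setI andb_idr// => _.
  have /andP[h5 h6] := band_middle_itv _ kK.
  by rewrite inE/= in_itv/= acos_ge0 ?(ltW h5) ?(ltW h6)//= acos_ltpi// h5 ltW.
move=> h; rewrite (le_trans h)// le_eqVlt; apply/orP; left; apply/eqP.
ring.
Qed.

End latitudes.

(** * Area of a cap *)

Definition meridian_mass {R : realType} (u : E3 R) (t phi : R) : R :=
  \int[lebesgue_measure]_(x in
    trig_half u.2 (u.1.1 * cos phi + u.1.2 * sin phi) t `&` `[0, pi[) sin x.

Lemma spherical_coord_cap {R : realType} (u : E3 R) (t : R) (a : R * R) :
  cap u t (spherical_coord a) <->
  trig_half u.2 (u.1.1 * cos a.2 + u.1.2 * sin a.2) t a.1.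
Proof.
rewrite /cap /trig_half /unit_sphere /inner /spherical_coord/=.
have -> : sin a.1 * cos a.2 * (sin a.1 * cos a.2) +
    sin a.1 * sin a.2 * (sin a.1 * sin a.2) + cos a.1 * cos a.1 = 1.
  have := sin2cos2 a.1; have := sin2cos2 a.2.
  set s1 := sin a.1; set s2 := sin a.2; set c1 := cos a.1; set c2 := cos a.2.
  move=> h2 h1; ring: h1 h2.
have -> : sin a.1 * cos a.2 * u.1.1 + sin a.1 * sin a.2 * u.1.2 + cos a.1 * u.2 =
   u.2 * cos a.1 + (u.1.1 * cos a.2 + u.1.2 * sin a.2) * sin a.1 by ring.
by split => [[]|].
Qed.

Lemma trig_half_swap {R : realType} (u : E3 R) (t x y : R) :
  trig_half u.2 (u.1.1 * cos y + u.1.2 * sin y) t x =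
  trig_half (sin x * u.1.1) (sin x * u.1.2) (t - cos x * u.2) y.
Proof.
rewrite /trig_half/= lerBlDl; congr (is_true (_ <= _)); ring.
Qed.

Lemma surface_measure_capE {R : realType} (u : E3 R) (t : R) :
  measurable_fun (`[0, 2 * pi[ : set R) (meridian_mass u t) /\
  surface_measure (cap u t) =
    (\int[lebesgue_measure]_(y in `[0%R, (2 * pi)%R[)
       (meridian_mass u t y)%:E)%E.
Proof.
pose mu := @lebesgue_measure R.
have mS : measurable_fun [set: R] (@sin R).
  by apply: continuous_measurable_fun; exact: continuous_sin.
have mC : measurable_fun [set: R] (@cos R).
  by apply: continuous_measurable_fun; exact: continuous_cos.
pose B : set (R * R) := spherical_dom `&` spherical_coord @^-1` cap u t.
have mB : measurable B.
  apply: measurableI; first exact: measurable_spherical_dom.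
  have -> : spherical_coord @^-1` cap u t =
      (fun a : R * R => inner (spherical_coord a) u) @^-1` `[t, +oo[.
    apply/seteqP; split => a /=; rewrite in_itv/= andbT; first by case.
    move=> h; apply/spherical_coord_cap; rewrite /trig_half/=.
    by move: h; rewrite /inner/spherical_coord/= => h; apply: (le_trans h); lra.
  rewrite -[X in measurable X]setTI.
  have m : measurable_fun [set: R * R]
      (fun a : R * R => inner (spherical_coord a) u).
    rewrite /inner /spherical_coord/=.
    have mS1 := measurableT_comp mS (@measurable_fst _ _ R R).
    have mC1 := measurableT_comp mC (@measurable_fst _ _ R R).
    have mS2 := measurableT_comp mS (@measurable_snd _ _ R R).
    have mC2 := measurableT_comp mC (@measurable_snd _ _ R R).
    apply: measurable_funD; last exact: measurable_funM.
    by apply: measurable_funD; apply: measurable_funM => //; exact: measurable_funM.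
  by apply: m => //; exact: measurable_itv.
pose f := (fun a : R * R => (sin a.1)%:E) \_ B.
have mf : measurable_fun setT f.
  apply/(measurable_restrictT _ _).1 => //.
  apply: measurable_funTS; apply/measurable_EFinP.
  exact: measurableT_comp mS measurable_fst.
have f0 a : (0 <= f a)%E.
  apply: erestrict_ge0 => {}a [[/= + _] _].
  by rewrite in_itv/= lee_fin; exact: sin_ge0_pi.
have Jm y := measurable_trig_half u.2 (u.1.1 * cos y + u.1.2 * sin y) t.
have fin y : (\int[mu]_(x in
      trig_half u.2 (u.1.1 * cos y + u.1.2 * sin y) t `&` `[0%R, pi[)
      (sin x)%:E)%E = (meridian_mass u t y)%:E.
  have mJ : measurable
      (trig_half u.2 (u.1.1 * cos y + u.1.2 * sin y) t `&` `[0, pi[).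
    by apply: measurableI => //; exact: measurable_itv.
  rewrite /meridian_mass /Rintegral fineK//.
  apply: integrable_fin_num => //; apply: integrableS (integrable_sin 0 pi) => //.
  by apply: subset_trans (@subIsetr _ _ _) _; apply: subset_itvl; rewrite bnd_simp.
have GE y : fubini_G mu f y = ((fun y => (meridian_mass u t y)%:E) \_ `[0, 2 * pi]) y.
  rewrite /fubini_G patchE; case: ifPn => hy; last first.
    apply: integral0_eq => x _; rewrite /f patchE; case: ifPn => // /set_mem[[/= _ yB] _].
    by case/negP: hy; rewrite inE.
  rewrite -fin [in RHS]setIC [RHS]integral_mkcondr.
  rewrite integral_itv_bndo_bndc; last first.
    apply: (@measurable_funS _ _ _ _ setT) => //.
    apply/(measurable_restrictT _ _).1 => //.
    by apply: measurable_funTS; apply/measurable_EFinP.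
  rewrite -[RHS]integral_mkcondr [RHS]integral_mkcond; apply: eq_integral => x _.
  rewrite /f !patchE; congr (if _ then _ else _); apply/idP/idP; rewrite !inE.
    by move=> [[/= hx _] /spherical_coord_cap].
  move=> [hx hJ]; split; last exact/spherical_coord_cap.
  by split => //; exact/set_mem.
have mG : measurable_fun setT (fubini_G mu f).
  exact: measurable_fun_fubini_tonelli_G.
have mm : measurable_fun (`[0, 2 * pi] : set R) (fun y => (meridian_mass u t y)%:E).
  apply/(measurable_restrictT _ _).2 => //.
  by rewrite (_ : _ \_ _ = fubini_G mu f)//; apply/funext => y; rewrite GE.
split.
  apply/measurable_EFinP; apply: measurable_funS mm => //.
  by apply: subset_itvl; rewrite bnd_simp.
rewrite integral_itv_bndo_bndc; last first.
  by apply: measurable_funS mm => //; apply: subset_itvl; rewrite bnd_simp.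
rewrite /surface_measure integral_mkcond -/B -/f fubini_tonelli2//.
by rewrite [RHS]integral_mkcond; apply: eq_integral => y _; exact: GE.
Qed.

Lemma Rintegral_sum_indic {d : measure_display} {X : measurableType d}
    {R : realType} (mu : {measure set X -> \bar R}) (D : set X) (K : nat)
    (c : nat -> R) (J : nat -> set X) :
  measurable D -> (mu D < +oo)%E -> (forall k, measurable (J k)) ->
  mu.-integrable D (EFin \o (fun x => \sum_(k < K) c k * \1_(J k) x)) /\
  \int[mu]_(x in D) (\sum_(k < K) c k * \1_(J k) x) =
    \sum_(k < K) c k * fine (mu (J k `&` D)).
Proof.
move=> mD Dfin mJ.
have iJ k : mu.-integrable D (EFin \o (fun x => \1_(J k) x)).
  apply: measurable_bounded_integrable => //.
    by apply: measurable_funTS; exact: measurable_indic.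
  exists 1; split; rewrite ?num_real// => x x1 y _ /=.
  by rewrite (le_trans _ (ltW x1))// indicE ger0_norm// lern1 leq_b1.
have icJ k : mu.-integrable D (EFin \o (fun x => c k * \1_(J k) x)).
  apply: (eq_integrable mD _ _ _ (integrableZl mD (c k) (iJ k))) => // x _.
elim: K => [|K [IH1 IH2]].
  have -> : (fun x => \sum_(k < 0) c k * \1_(J k) x) = cst 0 :> (X -> R).
    by apply/funext => x; rewrite big_ord0.
  rewrite big_ord0 Rintegral_cst// mul0r; split => //; exact: integrable0.
have -> : (fun x => \sum_(k < K.+1) c k * \1_(J k) x) =
   (fun x => \sum_(k < K) c k * \1_(J k) x + c K * \1_(J K) x) :> (X -> R).
  by apply/funext => x; rewrite big_ord_recr.
split.
  rewrite (_ : _ \o _ =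
      (EFin \o (fun x => (\sum_(k < K) c k * \1_(J k) x)%R)) \+
      (EFin \o (fun x => (c K * \1_(J K) x)%R)))%E; last first.
    by apply/funext => x; rewrite /= EFinD.
  exact: integrableD.
rewrite RintegralD// IH2 big_ord_recr/=; congr (_ + _).
rewrite RintegralZl//; congr (_ * _).
by rewrite /Rintegral integral_indic.
Qed.

Lemma cap_area_sampling {R : realType} (rho : nat -> R) (K : nat) (B : R)
    (u : E3 R) (t : R) (th := fun k => acos (band_middle rho K k)) :
  (0 < K)%N -> (forall k, (k < K)%N -> 0 < rho k <= B) ->
  `|fine (surface_measure (cap u t)) -
    \sum_(k < K) 2 * rho k / (\sum_(k < K) rho k) *
      fine (lebesgue_measure
       (trig_half (sin (th k) * u.1.1) (sin (th k) * u.1.2)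
                  (t - cos (th k) * u.2) `&` `[0, 2 * pi[))|
  <= 16 * pi * B / (\sum_(k < K) rho k).
Proof.
move=> K0 rhoB; set T := \sum_(k < K) rho k.
have [mg ->] := surface_measure_capE u t.
pose mu := @lebesgue_measure R.
pose D : set R := `[0, 2 * pi[%classic.
have mD : measurable D by exact: measurable_itv.
have pi0 : 0 < (pi : R) by exact: pi_gt0.
have muD : mu D = (2 * pi)%:E.
  by rewrite /mu lebesgue_measure_itv/= lte_fin mulr_gt0// oppr0 adde0.
have Dfin : (mu D < +oo)%E by rewrite muD ltry.
pose J k := trig_half (sin (th k) * u.1.1) (sin (th k) * u.1.2)
                  (t - cos (th k) * u.2).
pose w k := 2 * rho k / T.
have mJ k : measurable (J k) by exact: measurable_trig_half.
have [ih <-] := Rintegral_sum_indic mu D K w J mD Dfin mJ.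
set h := fun x => _ in ih *.
set g := meridian_mass u t in mg *.
have gh y : `|g y - h y| <= 8 * B / T.
  have := meridian_sampling rho K K0
    (fun k kK => proj1 (andP (rhoB k kK)))
    u.2 (u.1.1 * cos y + u.1.2 * sin y) t B
    (fun k kK => proj2 (andP (rhoB k kK))).
  rewrite -/T -/(meridian_mass u t y) -/g; apply: le_trans.
  rewrite /h le_eqVlt; apply/orP; left; apply/eqP; congr (`|_ - _|).
  by apply: eq_bigr => k _; rewrite /w !indicE; congr (_ * (_ : bool)%:R);
    apply/idP/idP; rewrite !inE /J trig_half_swap.
have ig : mu.-integrable D (EFin \o g).
  have /integrableP[mh _] := ih.
  apply: measurable_bounded_integrable => //.
  exists (8 * B / T + \sum_(k < K) `|w k|); split; rewrite ?num_real// => x xM y _ /=.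
  rewrite (le_trans _ (ltW xM))// (_ : g y = g y - h y + h y); last by rewrite subrK.
  rewrite (le_trans (ler_normD _ _))// lerD// (le_trans (ler_norm_sum _ _ _))//.
  apply: ler_sum => k _; rewrite normrM ler_piMr// indicE ger0_norm//.
  by rewrite lern1 leq_b1.
rewrite -/(Rintegral mu D g) -RintegralB//.
have iB : mu.-integrable D (EFin \o (g \- h)).
  rewrite (_ : _ \o _ = (EFin \o g) \- (EFin \o h))%E; first exact: integrableB.
  by apply/funext => x.
rewrite (le_trans (le_normr_Rintegral _ _))//.
apply: (@le_trans _ _ (\int[mu]_(x in D) (8 * B / T))).
  apply: le_Rintegral => //.
  - rewrite (_ : EFin \o _ = abse \o (EFin \o (g \- h)))//; exact: integrable_abse.
  - by apply: measurable_bounded_integrable => //; exact: bounded_cst.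
  - by move=> y _; exact: gh.
rewrite Rintegral_cst// (_ : fine _ = 2 * pi); last exact: (congr1 fine muD).
rewrite le_eqVlt; apply/orP; left; apply/eqP; ring.
Qed.

(** * The Diamond ensemble *)

Section parallels.
Context {R : realType} (P : diamond_parameters R) (M : nat).
Hypothesis MP : dp_Ms P M.

Lemma dp_t_le i j : (i <= j)%N -> (j <= dp_n P)%N -> (dp_t P M i <= dp_t P M j)%N.
Proof.
move=> ij; rewrite -(subnK ij); elim: (j - i)%N => //= k IH kn.
rewrite addSn (leq_trans (IH _))//; first by rewrite ltnW.
exact/ltnW/dp_t_lt.
Qed.

Lemma dp_piece j : (0 < j <= M)%N -> exists2 l, (1 <= l <= dp_n P)%N &
  (dp_t P M l.-1 < j <= dp_t P M l)%N.
Proof.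
move=> /andP[j0 jM].
have ex : exists l, (j <= dp_t P M l)%N by exists (dp_n P); rewrite dp_tn.
case: (ex_minnP ex) => l jl lmin; exists l.
  rewrite lmin ?dp_tn// andbT lt0n; apply: contraTneq jl => ->.
  by rewrite dp_t0// -ltnNge.
rewrite jl andbT ltnNge; apply/negP => /lmin.
case: l jl {lmin} => [|l] jl; last by rewrite ltnn.
by move: jl; rewrite dp_t0// leqNgt j0.
Qed.

Lemma rj_piece j l : (1 <= l <= dp_n P)%N ->
  (dp_t P M l.-1 <= j <= dp_t P M l)%N ->
  rj P M j = (dp_alpha P M l + dp_beta P M l * j)%:R.
Proof.
move=> ln /andP[h1 h2]; rewrite /rj (@dp_r_piece _ P M l)//.
  by rewrite natrD natrM.
by rewrite !ler_nat h1.
Qed.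

Lemma rj_sym j : (j <= 2 * M)%N -> rj P M j = rj P M (2 * M - j)%N.
Proof.
move=> jM; rewrite /rj dp_r_sym//; first by rewrite natrB// natrM.
by rewrite ler0n/= -natrM ler_nat.
Qed.

Lemma rj_first j : (0 < j <= dp_t P M 1)%N -> rj P M j = (dp_beta P M 1 * j)%:R.
Proof.
move=> /andP[j0 j1]; rewrite (rj_piece _ 1)/= ?dp_n_gt0//.
  by rewrite dp_alpha1.
by rewrite dp_t0.
Qed.

Lemma rj_half j : (0 < j <= M)%N ->
  exists2 n : nat, (0 < n)%N & rj P M j = n%:R /\ rj P M j <= 2 * dp_A P * M%:R.
Proof.
move=> /andP[j0 jM].
have H : 1 <= rj P M j.
  elim: j j0 jM => // -[_ _ M0|j IH _ jM].
    have t1 : (0 < dp_t P M 1)%N.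
      by rewrite -[ltnLHS](dp_t0 MP) (@dp_t_lt _ P M 1)// dp_n_gt0.
    by rewrite rj_first// muln1 ler1n dp_beta1.
  apply: (le_trans (IH _ _)) => //; first exact: ltnW.
  have [l ln /andP[l1 l2]] := dp_piece j.+2 jM.
  rewrite !(rj_piece _ l)//.
  - by rewrite ler_nat leq_add2l leq_mul2l leqnSn orbT.
  - by rewrite ltnW.
  - by rewrite -ltnS l1 ltnW.
have [l ln /andP[l1 l2]] := dp_piece j (introT andP (conj j0 jM)).
have E : rj P M j = (dp_alpha P M l + dp_beta P M l * j)%:R.
  by apply: rj_piece => //; rewrite l2 ltnW.
exists (dp_alpha P M l + dp_beta P M l * j)%N.
  by rewrite -(ltr_nat R) -E (lt_le_trans _ H).
split => //; rewrite E natrD natrM.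
have ha := @dp_alpha_le _ P M l MP ln; have hb := @dp_beta_le _ P M l MP ln.
have : (dp_beta P M l)%:R * j%:R <= dp_A P * M%:R.
  by rewrite ler_pM// ler_nat.
by rewrite -mulrA; lra.
Qed.

Lemma rj_nat j : (0 < j <= nparallels M)%N ->
  exists2 n : nat, (0 < n)%N & rj P M j = n%:R /\ rj P M j <= 2 * dp_A P * M%:R.
Proof.
rewrite /nparallels => /andP[j0 jM].
have [h|h] := leqP j M; first by apply: rj_half; rewrite j0.
by rewrite rj_sym; [apply: rj_half|]; lia.
Qed.

Lemma npointsE : npoints P M - 1 = 1 + \sum_(1 <= j < (nparallels M).+1) rj P M j.
Proof. by rewrite /npoints; ring. Qed.

Lemma npoints_ge : (dp_c P * M%:R) ^+ 2 / 2 <= npoints P M - 1.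
Proof.
have M0 := dp_Ms_gt0 MP.
have t1M : (dp_t P M 1 <= M)%N by rewrite -{2}(dp_tn MP) dp_t_le// dp_n_gt0.
rewrite npointsE (@big_cat_nat _ _ _ (dp_t P M 1).+1)//=; last first.
  by rewrite /nparallels; lia.
have h2 : 0 <= \sum_((dp_t P M 1).+1 <= i < (nparallels M).+1) rj P M i.
  rewrite big_nat; apply: sumr_ge0 => i /andP[i1 i2].
  by have [|n _ [-> _]] := rj_nat i; [rewrite (leq_ltn_trans _ i1)|exact: ler0n].
have h1 : ((dp_t P M 1)%:R : R) ^+ 2 / 2 <= \sum_(1 <= i < (dp_t P M 1).+1) rj P M i.
  apply: (@le_trans _ _ (\sum_(1 <= i < (dp_t P M 1).+1) i%:R)).
    elim: (dp_t P M 1) => [|k IH]; first by rewrite expr0n/= mul0r big_nil.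
    rewrite big_nat_recr//=; move: IH; set s := \sum_(_ <= _ < _) _ => IH.
    by rewrite -[k.+1%:R]natr1; have : 0 <= k%:R :> R by []; nra.
  rewrite big_nat [leRHS]big_nat; apply: ler_sum => i /andP[i1 i2].
  by rewrite rj_first ?i1// ler_nat leq_pmull// dp_beta1.
have h3 : (dp_c P * M%:R) ^+ 2 <= ((dp_t P M 1)%:R : R) ^+ 2.
  rewrite lerXn2r ?nnegrE ?dp_t1_ge//.
  by rewrite mulr_ge0// ltW// dp_c_gt0.
by set s1 := \sum_(_ <= _ < _) _ in h1 *; set s2 := \sum_(_ <= _ < _) _ in h2 *; lra.
Qed.

Lemma npoints_le : npoints P M <= (2 + 4 * dp_A P) * M%:R ^+ 2.
Proof.
have M0 : (1 <= M%:R :> R) by rewrite ler1n (dp_Ms_gt0 MP).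
have A2 := dp_A_ge2 P.
have : \sum_(1 <= j < (nparallels M).+1) rj P M j <=
       \sum_(1 <= j < (nparallels M).+1) (2 * dp_A P * M%:R).
  rewrite big_nat [leRHS]big_nat; apply: ler_sum => i hi.
  by have [//|n _ []] := rj_nat i.
rewrite sumr_const_nat subSS subn0 -[_ *+ _ in leRHS]mulr_natr /npoints.
set s := \sum_(_ <= _ < _) _.
have : (nparallels M)%:R <= 2 * M%:R :> R.
  by rewrite -natrM ler_nat /nparallels leq_subr.
move=> h1 h2.
have h3 : 2 * dp_A P * M%:R * (nparallels M)%:R <= 2 * dp_A P * M%:R * (2 * M%:R).
  by apply: ler_wpM2l => //; apply: mulr_ge0 => //; lra.
have h4 : 1 <= M%:R ^+ 2 :> R by rewrite exprn_ege1.
by lra.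
Qed.

End parallels.

Lemma cos_eq1 {R : realType} (x : R) : 0 <= x < 2 * pi -> cos x = 1 -> x = 0.
Proof.
move=> /andP[x0 x2] cx.
have : cos (x / 2 + x / 2) = 1 by rewrite -splitr.
rewrite cosD; have := cos2sin2 (x / 2); rewrite !expr2 => -> h.
have /eqP : sin (x / 2) * sin (x / 2) = 0 by lra.
rewrite mulf_eq0 orbb => /eqP s0.
apply/eqP; rewrite eq_le x0 andbT leNgt; apply/negP => xpos.
have : 0 < sin (x / 2) by apply: sin_gt0_pi; apply/andP; split; lra.
by rewrite s0 ltxx.
Qed.

Lemma cos_sin_inj {R : realType} (x y : R) : `|x - y| < 2 * pi ->
  cos x = cos y -> sin x = sin y -> x = y.
Proof.
wlog yx : x y / y <= x => [H|] hxy cxy sxy.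
  have [/H|/ltW/H] := leP y x; first exact.
  by rewrite distrC => /(_ hxy (esym cxy) (esym sxy)).
apply/eqP; rewrite -subr_eq0; apply/eqP/cos_eq1.
  by move: hxy; rewrite ger0_norm subr_ge0// => ->; rewrite yx.
by rewrite cosB cxy sxy -!expr2 cos2Dsin2.
Qed.

Lemma card_pts_seq {R : realType} (s : seq (E3 R)) (A : set (E3 R)) :
  uniq s -> card_pts ([set` s] `&` A) = \sum_(x <- s) \1_A x.
Proof.
move=> us; rewrite /card_pts.
have -> : [set` s] `&` A = [set` [fset x in [seq x <- s | x \in A]]%fset].
  apply/seteqP; split => x /=.
  - move=> [xs xA]; rewrite !inE/= mem_filter xs andbT.
    exact: mem_set.
  by rewrite !inE/= mem_filter => /andP[/set_mem xA xs].
rewrite set_fsetK card_fseq undup_id ?filter_uniq// size_filter.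
by rewrite -sum1_count natr_sum big_mkcond/=; apply: eq_bigr => x _; rewrite indicE; case: ifP.
Qed.

Section diamond_cap.
Context {R : realType} (P : diamond_parameters R) (M : nat) (theta : nat -> R).
Hypothesis MP : dp_Ms P M.

Definition rnat (j : nat) : nat := Num.truncn (rj P M j).

Lemma rnatP j : (0 < j <= nparallels M)%N -> (0 < rnat j)%N /\ rj P M j = (rnat j)%:R.
Proof.
by move=> hj; have [n n0 [e _]] := rj_nat P M MP j hj; rewrite /rnat e natrK.
Qed.

(* The polar caps are treated as two additional bands, each of weight 1/2. *)
Definition rho (k : nat) : R :=
  if (k == 0) || (k == (nparallels M).+1) then 1 / 2 else rj P M k.

Lemma sum_rho j : (0 < j <= (nparallels M).+1)%N ->
  \sum_(i < j) rho i = 1 / 2 + \sum_(1 <= k < j) rj P M k.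
Proof.
move=> /andP[j0 jp]; rewrite -(big_mkord xpredT) big_ltn//; congr (_ + _).
rewrite big_nat [RHS]big_nat; apply: eq_bigr => i /andP[i1 ij].
by rewrite /rho -[i == 0%N]negbK -lt0n i1/= ltn_eqF// (leq_trans ij).
Qed.

Lemma sum_rhoT : \sum_(i < (nparallels M).+2) rho i = npoints P M - 1.
Proof.
rewrite big_ord_recr/= sum_rho ?leqnn// /rho eqxx orbT /npoints.
set s := \sum_(_ <= _ < _) _; lra.
Qed.

Lemma rho_itv k : (k < (nparallels M).+2)%N -> 0 < rho k <= 2 * dp_A P * M%:R.
Proof.
move=> kp; rewrite /rho.
have A2 := dp_A_ge2 P; have M1 : 1 <= M%:R :> R by rewrite ler1n (dp_Ms_gt0 MP).
case: ifPn; first by move=> _; apply/andP; split; nra.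
rewrite negb_or -lt0n => /andP[k0 kp1].
have [|n n0 [e h]] := rj_nat P M MP k; first by rewrite k0; lia.
by rewrite h andbT e ltr0n.
Qed.

Lemma zj_band j : (0 < j <= nparallels M)%N ->
  zj P M j = band_middle rho (nparallels M).+2 j.
Proof.
move=> /andP[j0 jp]; have := sum_rho j; rewrite j0 (leqW jp) => /(_ isT) h.
have er : rho j = rj P M j by rewrite /rho -[j == 0%N]negbK -lt0n j0/= ltn_eqF.
rewrite /zj -sum_rhoT /band_middle er h; congr (1 - _ / _).
set s := \sum_(_ <= _ < _) _; lra.
Qed.

Lemma zj_itv j : (0 < j <= nparallels M)%N -> -1 < zj P M j < 1.
Proof.
move=> hj; rewrite zj_band//; apply: band_middle_itv => //.
- by move=> k /rho_itv/andP[].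
- by case/andP: hj => _ jp; rewrite ltnS ltnW.
Qed.

Lemma zj_lt i j : (0 < i)%N -> (i < j <= nparallels M)%N -> zj P M j < zj P M i.
Proof.
move=> i0 /andP[ij jp]; rewrite !zj_band ?i0 ?(leq_trans (ltnW ij))//; last first.
  by rewrite jp (ltn_trans i0).
apply: band_middle_decr => //; last by rewrite ij ltnS ltnW.
by move=> k /rho_itv/andP[].
Qed.

Lemma diamond_point_spherical j i : (0 < j <= nparallels M)%N ->
  diamond_point P M theta j i = spherical_coord
   (acos (band_middle rho (nparallels M).+2 j),
    2 * pi * i%:R / rj P M j + theta j).
Proof.
move=> hj; rewrite -zj_band// /spherical_coord/=.
have /andP[z1 z2] := zj_itv j hj.
by rewrite sin_acos ?(ltW z1) ?(ltW z2)// acosK// in_itv/= !ltW.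
Qed.

Definition diamond_seq : seq (E3 R) :=
  [:: (0, 0, 1); (0, 0, -1)] ++
  [seq diamond_point P M theta j i | j <- iota 1 (nparallels M),
                                     i <- iota 1 (rnat j)].

Lemma diamondE : diamond P M theta = [set` diamond_seq].
Proof.
apply/seteqP; split => x.
  rewrite /diamond_seq/= !inE orbA => -[[->|->]|]; rewrite ?eqxx ?orbT//.
  move=> [j [i [hj i1 ir ->]]]; apply/orP; right; apply/allpairsPdep.
  have [r0 e] := rnatP j hj.
  exists j, i; split => //; rewrite mem_iota add1n; first by rewrite ltnS.
  by rewrite i1 ltnS -(ler_nat R) -e.
rewrite /diamond_seq/= !inE orbA => /orP[/orP[]/eqP ->|]; [by left; left|by left; right|].
move=> /allpairsPdep[j [i [hj hi ->]]]; right; exists j, i.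
move: hj hi; rewrite !mem_iota !add1n !ltnS => hj /andP[i1 ir].
by have [r0 ->] := rnatP j hj; rewrite ler_nat.
Qed.

Lemma diamond_seq_uniq : uniq diamond_seq.
Proof.
have hz j i : j \in iota 1 (nparallels M) ->
    -1 < (diamond_point P M theta j i).2 < 1.
  by rewrite mem_iota add1n ltnS => hj; exact: zj_itv.
rewrite cat_uniq; apply/and3P; split.
- rewrite /= andbT inE; apply/eqP => -[] h; lra.
- apply/hasPn => x /allpairsPdep[j [i [hj hi ->]]].
  have := hz j i hj; rewrite !inE; apply: contraTN => /orP[]/eqP ->/=.
    by rewrite ltxx andbF.
  by rewrite ltxx.
- apply: allpairs_uniq_dep; first exact: iota_uniq.
    by move=> j _; exact: iota_uniq.
  move=> _ _ /allpairsPdep[j [i [hj hi ->]]] /allpairsPdep[j' [i' [hj' hi' ->]]]/=.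
  move: hj hi hj' hi'; rewrite !mem_iota !add1n !ltnS => hj hi hj' hi' e.
  have ejj : j = j'.
    have ez : zj P M j = zj P M j' by exact: (congr1 snd e).
    case: (ltngtP j j') => // h.
    - have := zj_lt j j' (proj1 (andP hj)).
      by rewrite h (proj2 (andP hj')) ez ltxx => /(_ isT).
    - have := zj_lt j' j (proj1 (andP hj')).
      by rewrite h (proj2 (andP hj)) ez ltxx => /(_ isT).
  rewrite -{}ejj in hj' hi' e *; congr Tagged.
  have [r0 er] := rnatP j hj.
  have rR : 0 < (rnat j)%:R :> R by rewrite ltr0n.
  have s0 : Num.sqrt (1 - zj P M j ^+ 2) != 0.
    have /andP[z1 z2] := zj_itv j hj.
    by rewrite gt_eqF// sqrtr_gt0; nra.
  have ec := mulfI s0 (congr1 (fun x => x.1.1) e).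
  have es := mulfI s0 (congr1 (fun x => x.1.2) e).
  have pi0 := pi_gt0 R.
  have hd : 2 * pi * i%:R / rj P M j + theta j -
     (2 * pi * i'%:R / rj P M j + theta j) =
     2 * pi * ((i%:R - i'%:R) / (rnat j)%:R) by rewrite er; ring.
  have /cos_sin_inj-/(_ ec es) : `|2 * pi * i%:R / rj P M j + theta j -
     (2 * pi * i'%:R / rj P M j + theta j)| < 2 * pi.
    rewrite hd normrM ger0_norm; last by rewrite mulr_ge0// ltW.
    rewrite gtr_pMr ?mulr_gt0// normrM normfV (ger0_norm (ltW rR)) ltr_pdivrMr// mul1r.
    move: hi hi'; rewrite -!(ler_nat R) => /andP[h1 h2] /andP[h3 h4].
    by rewrite ltr_norml; apply/andP; split; lra.
  move=> /eqP; rewrite -subr_eq0 hd !mulf_eq0 invr_eq0.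
  by rewrite (gt_eqF pi0) (gt_eqF rR) pnatr_eq0 !orbF/= subr_eq0 eqr_nat => /eqP.
Qed.

Lemma card_diamond_cap (A : set (E3 R)) :
  card_pts (diamond P M theta `&` A) =
  \1_A (0, 0, 1) + \1_A (0, 0, -1) +
  \sum_(1 <= j < (nparallels M).+1) \sum_(1 <= i < (rnat j).+1)
     \1_A (diamond_point P M theta j i).
Proof.
rewrite diamondE card_pts_seq ?diamond_seq_uniq// big_cat/= !big_cons big_nil addr0.
congr (_ + _); rewrite big_allpairs_dep /index_iota subSS subn0.
by apply: eq_bigr => j _; rewrite subSS subn0.
Qed.

Lemma card_diamond : card_pts (diamond P M theta) = npoints P M.
Proof.
rewrite -[diamond _ _ _]setIT card_diamond_cap !indicE !in_setT /npoints.
congr (_ + _); rewrite big_nat [RHS]big_nat; apply: eq_bigr => j hj.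
have [_ ->] := rnatP j hj.
under eq_bigr do rewrite indicE in_setT.
by rewrite sumr_const_nat subSS subn0.
Qed.

End diamond_cap.

Lemma indic_ge0_le1 {X : Type} {R : realType} (A : set X) (x : X) :
  0 <= (\1_A x : R) <= 1.
Proof. by rewrite indicE ler0n lern1 leq_b1. Qed.

Lemma fine_lebesgue_sub {R : realType} (J : set R) (a b : R) : a <= b ->
  measurable J -> 0 <= fine (lebesgue_measure (J `&` `[a, b[)) <= b - a.
Proof.
move=> ab mJ; rewrite fine_ge0//=.
have mab : measurable (`[a, b[%classic : set R) by exact: measurable_itv.
have mJab : measurable (J `&` `[a, b[) by exact: measurableI.
have h : (lebesgue_measure (J `&` `[a, b[) <= (b - a)%:E)%E.
  apply: (@le_trans _ _ (lebesgue_measure (`[a, b[%classic : set R))).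
    by apply: le_measure; rewrite ?inE.
  by rewrite lebesgue_measure_itv/= lte_fin; case: ifPn => // _; rewrite lee_fin subr_ge0.
by rewrite -lee_fin fineK// ge0_fin_numE// (le_lt_trans h)// ltry.
Qed.

Section cap_bound.
Context {R : realType} (P : diamond_parameters R) (M : nat) (theta : nat -> R).
Hypothesis MP : dp_Ms P M.
Hypothesis theta_ge0 : forall j, (0 < j <= nparallels M)%N -> 0 <= theta j.
Variables (u : E3 R) (t : R).

Let colat j : R := acos (band_middle (rho P M) (nparallels M).+2 j).
Let J j : set R := trig_half (sin (colat j) * u.1.1) (sin (colat j) * u.1.2)
  (t - cos (colat j) * u.2).
Let len j : R := fine (lebesgue_measure (J j `&` `[0, 2 * pi[)).
Let cnt j : R := \sum_(1 <= i < (rnat P M j).+1)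
  \1_(cap u t) (diamond_point P M theta j i).

Let T_gt0 : 0 < npoints P M - 1.
Proof.
apply: lt_le_trans (npoints_ge P M MP).
by rewrite divr_gt0// exprn_gt0// mulr_gt0 ?dp_c_gt0// ltr0n (dp_Ms_gt0 MP).
Qed.

Let parallel_count j : (0 < j <= nparallels M)%N ->
  `|len j - 2 * pi / rj P M j * cnt j| <= 8 * (2 * pi / rj P M j).
Proof.
move=> hj; have [r0 er] := rnatP P M MP j hj; rewrite er.
have := circle_count (sin (colat j) * u.1.1) (sin (colat j) * u.1.2)
  (t - cos (colat j) * u.2) (theta j) _ r0 (theta_ge0 j hj).
rewrite -/(J j) -/(len j); apply: le_trans.
rewrite le_eqVlt; apply/orP; left; apply/eqP; congr (`|_ - _ * _|).
apply: eq_bigr => i _; rewrite !indicE; congr ((_ : bool)%:R).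
rewrite diamond_point_spherical// er; apply/idP/idP; rewrite !inE.
  by move=> /spherical_coord_cap; rewrite trig_half_swap.
by move=> h; apply/spherical_coord_cap; rewrite trig_half_swap.
Qed.

Let S : R := \sum_(1 <= j < (nparallels M).+1) cnt j.

Let S_itv : 0 <= S <= npoints P M - 2.
Proof.
have -> : npoints P M - 2 = \sum_(1 <= j < (nparallels M).+1) rj P M j.
  by rewrite /npoints; ring.
rewrite sumr_ge0/=; last first.
  by move=> j _; apply: sumr_ge0 => i _; case/andP: (indic_ge0_le1 (R := R) (cap u t)
     (diamond_point P M theta j i)).
rewrite [leLHS]big_nat [leRHS]big_nat; apply: ler_sum => j hj.
have [r0 ->] := rnatP P M MP j hj.
apply: (@le_trans _ _ (\sum_(1 <= i < (rnat P M j).+1) 1)).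
  by apply: ler_sum => i _; case/andP: (indic_ge0_le1 (R := R) (cap u t)
     (diamond_point P M theta j i)).
by rewrite sumr_const_nat subSS subn0.
Qed.

Lemma cap_area_count :
  `|fine (surface_measure (cap u t)) - 4 * pi / (npoints P M - 1) * S|
  <= pi * (32 * dp_A P * M%:R + 32 * (nparallels M)%:R + 4) / (npoints P M - 1).
Proof.
have pi0 := pi_gt0 R.
have T0 := T_gt0.
have := cap_area_sampling (rho P M) (nparallels M).+2 (2 * dp_A P * M%:R) u t
  isT (rho_itv P M MP).
rewrite sum_rhoT; set T := npoints P M - 1 in T0 *.
rewrite -/colat -(big_mkord xpredT (fun k => 2 * rho P M k / T * len k)).
rewrite big_ltn// big_nat_recr//=.
have rho0 : rho P M 0 = 1 / 2 by rewrite /rho eqxx.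
have rhop : rho P M (nparallels M).+1 = 1 / 2 by rewrite /rho eqxx orbT.
rewrite rho0 rhop.
have len_itv k : 0 <= len k <= 2 * pi.
  have := fine_lebesgue_sub (J k) 0 (2 * pi).
  rewrite subr0; apply; first by rewrite mulr_ge0// ltW.
  exact: measurable_trig_half.
have polar k : 0 <= 2 * (1 / 2) / T * len k <= 2 * pi / T.
  have /andP[l0 l1] := len_itv k.
  have -> : 2 * (1 / 2) / T * len k = len k / T by rewrite mul1r divff// mul1r mulrC.
  by rewrite divr_ge0 ?(ltW T0)//= ler_pM2r// invr_gt0.
have := polar 0%N; have := polar (nparallels M).+1.
set a := 2 * (1 / 2) / T * len 0; set b := 2 * (1 / 2) / T * len _.
set s1 := \sum_(1 <= i < (nparallels M).+1) _.
have : `|s1 - 4 * pi / T * S| <= 32 * pi / T * (nparallels M)%:R.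
  rewrite /s1 /S mulr_sumr -sumrB (le_trans (ler_norm_sum _ _ _))//.
  have -> : 32 * pi / T * (nparallels M)%:R =
      \sum_(1 <= j < (nparallels M).+1) 32 * pi / T.
    by rewrite sumr_const_nat subSS subn0 mulr_natr.
  rewrite [leLHS]big_nat [leRHS]big_nat.
  apply: ler_sum => j hj.
  have := parallel_count j hj.
  have [r0 er] := rnatP P M MP j hj.
  have -> : rho P M j = rj P M j.
    rewrite /rho; case: ifPn => // /orP[]/eqP e; move: hj; rewrite e ?ltnn ?andbF//.
  have rR : 0 < rj P M j by rewrite er ltr0n.
  move=> h.
  have -> : 2 * rj P M j / T * len j - 4 * pi / T * cnt j =
     2 * rj P M j / T * (len j - 2 * pi / rj P M j * cnt j).
    by field; rewrite !gt_eqF.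
  rewrite normrM ger0_norm; last by rewrite divr_ge0 ?mulr_ge0// ltW.
  apply: (@le_trans _ _ (2 * rj P M j / T * (8 * (2 * pi / rj P M j)))).
    by rewrite ler_wpM2l// divr_ge0 ?mulr_ge0// ltW.
  rewrite le_eqVlt; apply/orP; left; apply/eqP.
  by field; rewrite !gt_eqF.
set mu := fine _; set q := 4 * pi / T * S.
rewrite !ler_norml => /andP[h1 h2] /andP[h3 h4] /andP[h5 h6] /andP[h7 h8].
set p := (nparallels M)%:R in h1 h2 *.
have -> : pi * (32 * dp_A P * M%:R + 32 * p + 4) / T =
  16 * pi * (2 * dp_A P * M%:R) / T + 32 * pi / T * p + 2 * (2 * pi / T) by ring.
by apply/andP; split; lra.
Qed.

Lemma diamond_cap_discrepancy :
  `|card_pts (diamond P M theta `&` cap u t) / card_pts (diamond P M theta) -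
    fine (surface_measure (cap u t)) / (4 * pi)|
  <= 2 * (8 * dp_A P + 19) / (dp_c P ^+ 2 * M%:R).
Proof.
have pi0 := pi_gt0 R; have T0 := T_gt0.
rewrite card_diamond// card_diamond_cap// -/cnt -/S.
have := cap_area_count; set mu := fine _.
have /andP[e1 e2] := indic_ge0_le1 (R := R) (cap u t) (0, 0, 1).
have /andP[e3 e4] := indic_ge0_le1 (R := R) (cap u t) (0, 0, -1).
set e := \1_(cap u t) (0, 0, 1) in e1 e2 *.
set e' := \1_(cap u t) (0, 0, -1) in e3 e4 *.
have /andP[S0 S1] := S_itv.
have Tge := npoints_ge P M MP.
set N := npoints P M in T0 S1 Tge *.
have N0 : 0 < N by lra.
have M1 : 1 <= M%:R :> R by rewrite ler1n (dp_Ms_gt0 MP).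
have pM : (nparallels M)%:R <= 2 * M%:R :> R.
  by rewrite -natrM ler_nat /nparallels leq_subr.
have A2 := dp_A_ge2 P; have c0 := dp_c_gt0 P.
have step1 : `|(e + e' + S) / N - S / (N - 1)| <= 2 / (N - 1).
  have -> : (e + e' + S) / N - S / (N - 1) =
     ((e + e') * (N - 1) - S) / (N * (N - 1)).
    by field; rewrite !gt_eqF.
  rewrite normrM normfV (ger0_norm (_ : 0 <= N * (N - 1))); last first.
    by apply: mulr_ge0; apply: ltW.
  rewrite ler_pdivrMr ?mulr_gt0//.
  have -> : 2 / (N - 1) * (N * (N - 1)) = 2 * N by field; rewrite gt_eqF.
  by rewrite ler_norml; apply/andP; split; nra.
have p4 : 0 < 4 * (pi : R) by rewrite mulr_gt0.
move=> h.
have step2 : `|S / (N - 1) - mu / (4 * pi)| <=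
    (8 * dp_A P * M%:R + 8 * (nparallels M)%:R + 1) / (N - 1).
  have -> : S / (N - 1) - mu / (4 * pi) =
      (4 * pi / (N - 1) * S - mu) / (4 * pi).
    have fld (x : R) : x != 0 ->
        S / (N - 1) - mu / (4 * x) = (4 * x / (N - 1) * S - mu) / (4 * x).
      by move=> x0; field; rewrite x0 gt_eqF.
    by apply: fld; rewrite gt_eqF.
  rewrite normrM normfV (gtr0_norm p4) ler_pdivrMr// distrC (le_trans h)//.
  rewrite le_eqVlt; apply/orP; left; apply/eqP; ring.
have -> : (e + e' + S) / N - mu / (4 * pi) =
  ((e + e' + S) / N - S / (N - 1)) + (S / (N - 1) - mu / (4 * pi)).
  by rewrite addrA subrK.
rewrite (le_trans (ler_normD _ _))// (le_trans (lerD step1 step2))//.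
rewrite -mulrDl ler_pdivrMr//.
have cM : 0 < dp_c P ^+ 2 * M%:R by rewrite mulr_gt0 ?exprn_gt0//; lra.
have h2 : 2 + (8 * dp_A P * M%:R + 8 * (nparallels M)%:R + 1) <=
   (8 * dp_A P + 19) * M%:R by lra.
apply: (le_trans h2).
rewrite mulrAC ler_pdivlMr//.
have h3 : (8 * dp_A P + 19) * (dp_c P * M%:R) ^+ 2 <=
          (8 * dp_A P + 19) * (2 * (N - 1)).
  by apply: ler_wpM2l; lra.
by move: h3; rewrite exprMn; lra.
Qed.

End cap_bound.

(** * From caps to the mean square discrepancy *)

Lemma le_integral_nonmeasurable {d : measure_display} {X : measurableType d}
    {R : realType} (mu : {measure set X -> \bar R}) (D : set X)
    (f g : X -> \bar R) : (forall x, D x -> (0 <= f x <= g x)%E) ->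
  (\int[mu]_(x in D) f x <= \int[mu]_(x in D) g x)%E.
Proof.
move=> fg.
have f0 x : D x -> (0 <= f x)%E by move=> /fg/andP[].
have g0 x : D x -> (0 <= g x)%E by move=> /fg/andP[]; exact: le_trans.
rewrite !ge0_integralE//; apply: le_ereal_sup => _ [h hf <-].
exists h => // x; apply: (le_trans (hf x)).
by apply: lee_restrict => y /fg/andP[].
Qed.

Lemma measurable_unit_sphere {R : realType} : measurable (@unit_sphere R).
Proof.
have m1 : measurable_fun setT (fun x : E3 R => x.1.1).
  exact: measurableT_comp measurable_fst measurable_fst.
have m2 : measurable_fun setT (fun x : E3 R => x.1.2).
  exact: measurableT_comp measurable_snd measurable_fst.
have m3 : measurable_fun setT (fun x : E3 R => x.2) by exact: measurable_snd.
have m : measurable_fun setT (fun x : E3 R => inner x x).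
  by apply: measurable_funD; [apply: measurable_funD|]; exact: measurable_funM.
by rewrite -[unit_sphere]setTI; exact: (m measurableT [set 1]).
Qed.

Lemma unit_sphere_area {R : realType} :
  surface_measure (@unit_sphere R) = (4 * pi)%:E.
Proof.
have pi0 := pi_gt0 R.
have -> : unit_sphere = cap ((0, 0, 0) : E3 R) 0.
  apply/seteqP; split => x /=; last by case.
  by split => //; rewrite /inner/= !mulr0 !addr0.
have [_ ->] := surface_measure_capE ((0, 0, 0) : E3 R) 0.
have mE y : meridian_mass ((0, 0, 0) : E3 R) 0 y = 2.
  rewrite /meridian_mass/= !mul0r addr0 (_ : trig_half 0 0 0 = setT).
    by rewrite setTI Rintegral_sin// cos0 cospi opprK.
  by apply/seteqP; split => // x _; rewrite /trig_half/= !mul0r addr0.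
under eq_integral do rewrite mE.
rewrite integral_cst//= lebesgue_measure_itv/= lte_fin mulr_gt0//.
by rewrite oppr0 adde0 -EFinM; congr (_%:E); ring.
Qed.

Lemma L2_cap_discrepancy_le {R : realType} (omega : set (E3 R)) (e : R) :
  0 <= e ->
  (forall u t, `|card_pts (omega `&` cap u t) / card_pts omega
     - fine (surface_measure (cap u t)) / (4 * pi)| <= e) ->
  (L2_cap_discrepancy omega <= (Num.sqrt 2 * e)%:E)%E.
Proof.
move=> e0 He; have pi0 := pi_gt0 R.
rewrite /L2_cap_discrepancy.
apply: (@le_trans _ _ (sqrte (2 * e ^+ 2)%:E)); last first.
  by rewrite /= sqrtrM// sqrtr_sqr ger0_norm.
rewrite lee_sqrt; last by rewrite lee_fin mulr_ge0// exprn_ge0.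
apply: (@le_trans _ _ (\int[@lebesgue_measure R]_(t in `[(-1)%R, 1%R])
   (e ^+ 2)%:E)%E); last first.
  rewrite integral_cst//= lebesgue_measure_itv/= lte_fin.
  rewrite ifT; last by lra.
  rewrite -EFinB -EFinM.
  by rewrite lee_fin; lra.
apply: le_integral_nonmeasurable => t _; apply/andP; split.
  apply: integral_ge0 => u _; rewrite lee_fin divr_ge0 ?exprn_ge0//.
  by rewrite mulr_ge0// ltW.
apply: (@le_trans _ _ (\int[@surface_measure R]_(u in unit_sphere)
   (e ^+ 2 / (4 * pi))%:E)%E).
  apply: le_integral_nonmeasurable => u _; rewrite !lee_fin.
  rewrite divr_ge0 ?exprn_ge0 ?mulr_ge0 ?(ltW pi0)//=.
  rewrite ler_pM2r ?invr_gt0 ?mulr_gt0// lerXn2r ?nnegrE//.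
rewrite integral_cst//; last exact: measurable_unit_sphere.
rewrite [X in (_ * X)%E](@unit_sphere_area R) -EFinM lee_fin divfK//.
by rewrite gt_eqF// mulr_gt0.
Qed.

Theorem corollary1p3 (R : realType) (P : diamond_parameters R) :
  exists c2 : R, forall (M : nat) (theta : nat -> R),
    dp_Ms P M ->
    (forall j, (1 <= j <= nparallels M)%N -> 0 <= theta j <= 2 * pi) ->
    (L2_cap_discrepancy (diamond P M theta)
       <= (c2 / Num.sqrt (npoints P M))%:E)%E.
Proof.
have A2 := dp_A_ge2 P; have c0 := dp_c_gt0 P.
pose C := 2 * (8 * dp_A P + 19) / dp_c P ^+ 2.
have C0 : 0 <= C by rewrite divr_ge0 ?exprn_ge0 ?(ltW c0)//; lra.
exists (Num.sqrt 2 * (C * Num.sqrt (2 + 4 * dp_A P))) => M theta MP htheta.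
have M0 : 0 < M%:R :> R by rewrite ltr0n (dp_Ms_gt0 MP).
have N0 : 0 < npoints P M.
  have := npoints_ge P M MP; have : 0 <= (dp_c P * M%:R) ^+ 2 by rewrite exprn_ge0// mulr_ge0// ltW.
  by lra.
have bound : C / M%:R <= C * Num.sqrt (2 + 4 * dp_A P) / Num.sqrt (npoints P M).
  rewrite -mulrA ler_wpM2l// ler_pdivlMr ?sqrtr_gt0// ler_pdivrMl// mulrC.
  rewrite -[X in _ <= _ * X](ger0_norm (ltW M0)) -sqrtr_sqr -sqrtrM; last by lra.
  by rewrite ler_sqrt ?npoints_le// mulr_ge0 ?exprn_ge0//; lra.
apply: le_trans (L2_cap_discrepancy_le _ (C / M%:R) _ _) _.
- by rewrite divr_ge0// ltW.
- move=> u t; rewrite /C -mulrA -invfM.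
  exact: diamond_cap_discrepancy P M theta MP
    (fun j hj => proj1 (andP (htheta j hj))) u t.
- by rewrite lee_fin -[leRHS]mulrA; apply: ler_wpM2l; rewrite ?sqrtr_ge0.
Qed.
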